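(* Let $m$, $k$, and $N$ be natural numbers with $k\geq 12$. If $m$ and $k$ are divisible by $3$, then there exists a 2-connected cubic graph $G$ with at least $N$ vertices such that no cycle of $G$ has length congruent to $m$ modulo $k$.
   Context: All graphs are finite and simple. A cubic graph is a graph in which every vertex has degree 3. *)

(* Defs.v *)
From mathcomp Require Import all_boot.

Set Implicit Arguments.
Unset Strict Implicit.
Unset Printing Implicit Defensive.

Record sgraph := SGraph {
  vertex :> finType;
  adj : rel vertex;
  adj_sym : symmetric adj;
  adj_irrefl : irreflexive adj
}.

Arguments adj {s} : rename.

Definition neighbours (G : sgraph) (x : G) : {set G} := [set y | adj x y].

Definition cubic (G : sgraph) : Prop := forall x : G, #|neighbours x| = 3.

(* The adjacency relation of G - X. *)
Definition adj_minus (G : sgraph) (X : {set G}) : rel G :=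
  [rel x y | [&& x \notin X, y \notin X & adj x y]].

Definition connected_minus (G : sgraph) (X : {set G}) : Prop :=
  forall x y : G, x \notin X -> y \notin X -> connect (adj_minus X) x y.

(* G has more than d vertices, and deleting fewer than d vertices never
   disconnects it; d = 2 gives 2-connectedness. *)
Definition vertex_connected (d : nat) (G : sgraph) : Prop :=
  d < #|G| /\ forall X : {set G}, #|X| < d -> connected_minus X.

(* A cycle is given by the list of its vertices in cyclic order; ucycle by
   itself also accepts the empty list and a single edge [:: x; y], whence the
   bound on the size. The length of the cycle is size c. *)
Definition is_cycle (G : sgraph) (c : seq G) : Prop :=
  2 < size c /\ ucycle adj c.

(* Main.v *)
(** A graph with two terminals of degree 2, all other vertices having degree 3,
is a gadget; two gadgets joined by two edges between their terminals form a ring.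
A cycle of a graph with a 2-edge cut either stays on one side or consists of one
path through each side, so only the numbers l of vertices of the
terminal-to-terminal paths matter.

Wrapping a gadget in an edge uv (each terminal attached to one of u, v) replaces
l by 2 or 2 + l and creates cycles of length 2 + l. Attaching it to two opposite
vertices of a 4-cycle replaces l by 3 or 4 + l and creates cycles of length 4 or
3 + l. If every l is 0 modulo 3 except for one exact value z = 2 modulo 3, then
wrapping followed by crossing creates no cycle of length divisible by 3 and
preserves this property, with z + 6 instead of z. Hence closing the initial gadget
into a ring with its n-fold extension creates a single new length divisible by 3,
namely 6n + 2z + 2. As k does not divide 6, one of any two consecutive n keeps it
away from m modulo k.

The initial gadget consists of two parallel copies of K4 minus an edge, with
z = 5 and cycle lengths 3, 4, 8, 9, 10, or, when m is 3 or 9 modulo k, of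
K_{3,3} minus an edge, with z = 8 and cycle lengths 4, 6, 10, 12, 14. *)

Require Import Defs.
From mathcomp Require Import all_boot zify.

Set Implicit Arguments.
Unset Strict Implicit.
Unset Printing Implicit Defensive.

Lemma head_neq_last (T : eqType) (x : T) p : 1 < size p -> uniq p -> head x p != last x p.
Proof. by case: p => [|y [|z p]] //= _ /andP[+ _]; apply: contraNneq => ->; apply: mem_last. Qed.

Section Paths.

Variable G : sgraph.
Implicit Types (x y : G) (p q : seq G) (n : nat).

Definition is_spath x p y : Prop := [/\ path adj x p, last x p = y & uniq (x :: p)].

(* Throughout, the length of a path is its number of vertices. *)
Definition has_spath x y n : Prop := exists2 p, is_spath x p y & n = (size p).+1.

Definition has_disjoint_spaths x x' y y' n : Prop :=
  exists p q, [/\ is_spath x p x', is_spath y q y', ~~ has [in x :: p] (y :: q)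
    & n = (size p).+1 + (size q).+1].

Definition has_cycle n : Prop := exists2 c : seq G, is_cycle c & n = size c.

Lemma has_spath_refl x n : has_spath x x n -> n = 1.
Proof. by case=> -[|y p] [_ /= lp up] ->; rewrite // -{1}lp mem_last in up. Qed.

Lemma has_spath_sym x y n : has_spath x y n -> has_spath y x n.
Proof.
case=> p [pp lp up] ->; exists (rev (belast x p)); last by rewrite size_rev size_belast.
have Erev : y :: rev (belast x p) = rev (x :: p) by rewrite [in RHS]lastI rev_rcons lp.
split; last by rewrite Erev rev_uniq.
- by rewrite -lp rev_path; apply: sub_path pp => u v; rewrite adj_sym.
- by case: p lp {pp up Erev} => [|z p] //= _; rewrite rev_cons last_rcons.
Qed.

Lemma has_spath_leq_card x y n : has_spath x y n -> n <= #|G|.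
Proof. by case=> p [_ _ up] ->; rewrite -[_.+1](card_uniqP up) max_card. Qed.

Lemma has_spath_nonadj x y n : x != y -> ~~ adj x y -> has_spath x y n -> 2 < n.
Proof.
move=> xy nadj [[|z [|z' p]] [pp /= lp _] ->] //; first by rewrite lp eqxx in xy.
by move: pp; rewrite /= lp (negbTE nadj).
Qed.

Lemma has_cycle_bounds n : has_cycle n -> 2 < n <= #|G|.
Proof. by case=> c [sc /andP[_ uc]] ->; rewrite sc -(card_uniqP uc) max_card. Qed.

Lemma is_cycle_catC p q : is_cycle (p ++ q) -> is_cycle (q ++ p).
Proof.
case=> spq /andP[cpq upq]; split; first by rewrite size_cat addnC -size_cat.
by rewrite -rot_size_cat /ucycle rot_cycle cpq rot_uniq.
Qed.

Lemma has_disjoint_spaths_refl x y n : has_disjoint_spaths x x y y n -> n = 2.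
Proof.
case=> p [q [Hp Hq _ ->]].
have -> : (size p).+1 = 1 by apply: (@has_spath_refl x); exists p.
by have -> : (size q).+1 = 1 by apply: (@has_spath_refl y); exists q.
Qed.

Lemma has_disjoint_spaths_common_source x y y' n : ~ has_disjoint_spaths x y x y' n.
Proof. by case=> p [q [_ _]]; rewrite /= mem_head. Qed.

Lemma has_disjoint_spaths_bounds x x' y y' n :
  uniq [:: x; x'; y; y'] -> has_disjoint_spaths x x' y y' n -> 4 <= n <= #|G|.
Proof.
move=> distinct [p [q [[_ lp up] [_ lq uq] pq ->]]].
have upq : uniq ((x :: p) ++ (y :: q)) by rewrite cat_uniq up uq pq.
rewrite -[_ + _](size_cat (x :: p) (y :: q)) -{2}(card_uniqP upq) max_card andbT.
apply: (uniq_leq_size distinct) => v; rewrite mem_cat -lp -lq.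
by rewrite [v \in [:: _; _; _; _]]inE 3!inE => /or4P[]/eqP->; rewrite ?mem_head ?mem_last ?orbT.
Qed.

End Paths.

Section InducedSubgraph.

Variables (G G' : sgraph) (f : G -> G').
Hypotheses (f_inj : injective f) (f_adj : {mono f : x y / adj x y}).

Lemma is_spath_map x p y : is_spath (f x) (map f p) (f y) -> is_spath x p y.
Proof.
case; rewrite (mono_path f_adj) last_map -(map_cons f) map_inj_uniq // => pp lp up.
by split=> //; apply: f_inj.
Qed.

Lemma is_cycle_map (c : seq G) : is_cycle (map f c) -> is_cycle c.
Proof. by case; rewrite size_map /ucycle (mono_cycle f_adj) map_inj_uniq. Qed.

End InducedSubgraph.

Section Bipartite.

Variables (G : sgraph) (f : G -> bool).
Hypothesis f_adj : forall x y, adj x y -> f x != f y.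

Lemma bipartite_path x p : path adj x p -> odd (size p) = f x (+) f (last x p).
Proof.
elim: p x => [|y p IH] x /=; first by rewrite addbb.
by case/andP=> /f_adj xy /IH ->; move: xy; case: (f x); case: (f y); case: (f _).
Qed.

Lemma bipartite_spath x y n : has_spath x y n -> odd n = (f x == f y).
Proof. by case=> p [/bipartite_path + <- _] -> /= => ->; case: (f x); case: (f _). Qed.

Lemma bipartite_cycle n : has_cycle G n -> ~~ odd n.
Proof.
case=> -[|x p] [// _ /andP[/= + _]] ->.
by rewrite rcons_path => /andP[/bipartite_path /= -> /f_adj]; case: (f x); case: (f _).
Qed.

End Bipartite.

Section Deletion.

Variable G : sgraph.
Implicit Types (X T : {set G}) (x y : G).

Definition reaches X T x : Prop := exists2 u, u \in T :\: X & connect (adj_minus X) x u.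

Definition anchored T : Prop := forall X x, #|X| <= 1 -> x \notin X -> reaches X T x.

Lemma adj_minus_sym X : connect_sym (adj_minus X).
Proof. by apply: sym_connect_sym => x y; rewrite /adj_minus /= [adj x y]adj_sym andbCA. Qed.

Lemma connected_minus_via X w :
  (forall x, x \notin X -> connect (adj_minus X) x w) -> connected_minus X.
Proof. by move=> Hw x y /Hw xw /Hw yw; apply: connect_trans xw _; rewrite adj_minus_sym. Qed.

Lemma connected_reaches T : connected_minus (set0 : {set G}) -> T != set0 ->
  forall x, reaches set0 T x.
Proof. by move=> cG /set0Pn[u uT] x; exists u; [rewrite setD0|apply: cG; rewrite inE]. Qed.

Lemma path_avoiding_connect X x p :
  path adj x p -> ~~ has [in X] (x :: p) -> connect (adj_minus X) x (last x p).
Proof.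
elim: p x => [|y p IH] x //= /andP[xy yp] /norP[xX ypX].
apply: connect_trans (IH y yp ypX); apply: connect1; rewrite /adj_minus /= xX xy andbT.
by case/norP: ypX.
Qed.

(* A single deleted vertex meets at most one of the two paths of a fan. *)
Lemma fan_reaches X T x p q :
    path adj x p -> last x p \in T -> path adj x q -> last x q \in T -> ~~ has [in p] q ->
  #|X| <= 1 -> x \notin X -> reaches X T x.
Proof.
move=> pp lp pq lq dpq cX xX.
have reach r : path adj x r -> last x r \in T -> ~~ has [in X] r -> reaches X T x.
  move=> pr lr rX; have xrX : ~~ has [in X] (x :: r) by rewrite /= negb_or xX.
  exists (last x r); last exact: path_avoiding_connect.
  rewrite inE lr andbT; apply: contra xrX => lX.
  by apply/hasP; exists (last x r); rewrite ?mem_last.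
have [/hasP[u up uX]|] := boolP (has [in X] p); last exact: reach.
apply: reach pq lq _; apply: contra dpq => /hasP[v vq vX].
by apply/hasP; exists v; rewrite //= (card_le1_eqP cX u v uX vX).
Qed.

End Deletion.

Lemma connect_homo (T T' : finType) (e : rel T) (e' : rel T') (f : T -> T') :
  {homo f : x y / e x y >-> e' x y} -> {homo f : x y / connect e x y >-> connect e' x y}.
Proof.
by move=> ef x y /connectP[p pp ->]; apply/connectP; exists (map f p);
  [apply: homo_path pp|rewrite last_map].
Qed.

Lemma card_preimset_le1 (T T' : finType) (f : T -> T') (X : {set T'}) :
  injective f -> #|X| <= 1 -> #|f @^-1: X| <= 1.
Proof.
move=> f_inj cX; apply/card_le1_eqP=> x y; rewrite !inE => xX yX; apply: f_inj.
exact: (card_le1_eqP cX).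
Qed.

Lemma sum_nat_eq_op (T : finType) (x : T) : \sum_y (y == x) = 1.
Proof. by rewrite -big_mkcond big_pred1_eq. Qed.

Lemma card_neighbours (G : sgraph) (x : G) : #|neighbours x| = \sum_y adj x y.
Proof. by rewrite cardsE -sum1_card big_mkcond. Qed.

Section Glue.

Variables (H A : sgraph) (a b : H) (s t : A).

Definition link (x : H) (y : A) : bool := (x == a) && (y == s) || (x == b) && (y == t).

Definition glue_adj (u v : H + A) : bool :=
  match u, v with
  | inl x, inl y => adj x y
  | inr x, inr y => adj x y
  | inl x, inr y => link x y
  | inr y, inl x => link x y
  end.

Lemma glue_adj_sym : symmetric glue_adj.
Proof. by move=> [x|x] [y|y] //=; rewrite adj_sym. Qed.

Lemma glue_adj_irrefl : irreflexive glue_adj.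
Proof. by move=> [x|x] /=; rewrite adj_irrefl. Qed.

Definition glue_graph : sgraph := SGraph glue_adj_sym glue_adj_irrefl.

Lemma card_glue : #|glue_graph| = #|H| + #|A|.
Proof. exact: card_sum. Qed.

Lemma link_left x : x \in [set a; b] -> exists y, link x y.
Proof.
by rewrite !inE => /orP[]/eqP->; [exists s|exists t]; rewrite /link !eqxx ?orbT.
Qed.

Lemma link_right y : y \in [set s; t] -> exists x, link x y.
Proof.
by rewrite !inE => /orP[]/eqP->; [exists a|exists b]; rewrite /link !eqxx ?orbT.
Qed.

Lemma glue_adj_inl : {mono (inl : H -> glue_graph) : x y / adj x y}.
Proof. by []. Qed.

Lemma glue_adj_inr : {mono (inr : A -> glue_graph) : x y / adj x y}.
Proof. by []. Qed.

Lemma glue_path_exit_left x p : path glue_adj (inl x) p ->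
  (exists q, p = map inl q) \/
  exists q y p', [/\ p = map inl q ++ inr y :: p', path adj x q, link (last x q) y
    & path glue_adj (inr y) p'].
Proof.
elim: p x => [|[x'|y] p IH] x /=; first by left; exists [::].
- case/andP=> xx' /IH[[q ->]|[q [y [p' [-> pq lqy pp']]]]]; [left|right].
    by exists (x' :: q).
  by exists (x' :: q), y, p'; rewrite /= xx'.
- by case/andP=> lxy pp; right; exists [::], y, p.
Qed.

Lemma glue_path_exit_right y p : path glue_adj (inr y) p ->
  (exists r, p = map inr r) \/
  exists r x p', [/\ p = map inr r ++ inl x :: p', path adj y r, link x (last y r)
    & path glue_adj (inl x) p'].
Proof.
elim: p y => [|[x|y'] p IH] y /=; first by left; exists [::].
- by case/andP=> lxy pp; right; exists [::], x, p.
- case/andP=> yy' /IH[[r ->]|[r [x [p' [-> pr lxr pp']]]]]; [left|right].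
    by exists (y' :: r).
  by exists (y' :: r), x, p'; rewrite /= yy'.
Qed.

Lemma glue_path_avoiding_right x p : path glue_adj (inl x) p -> inr s \notin p ->
  inr t \notin p -> exists q, p = map inl q.
Proof.
case/glue_path_exit_left=> [//|[q [y [p' [-> _ lqy _]]]]].
rewrite !mem_cat !inE !negb_or => /andP[_ /andP[sy _]] /andP[_ /andP[ty _]].
by case/orP: lqy sy ty => /andP[_ /eqP->]; rewrite eqxx.
Qed.

Section DistinctEnds.

Hypothesis ab : a != b.

Lemma link_functional x y y' : link x y -> link x y' -> y = y'.
Proof.
by move=> /orP[]/andP[/eqP-> /eqP->] /orP[]/andP[/eqP E /eqP->] //; case/eqP: ab.
Qed.

Lemma link_neq x y x' y' : link x y -> link x' y' -> x' != x ->
  [/\ x = a, y = s, x' = b & y' = t] \/ [/\ x = b, y = t, x' = a & y' = s].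
Proof.
by move=> /orP[]/andP[/eqP-> /eqP->] /orP[]/andP[/eqP-> /eqP->]; rewrite ?eqxx //; [left|right].
Qed.

(* Returning to H uses up the second link, so the path never enters A again. *)
Lemma glue_path_return x y d p :
    link x y -> path glue_adj (inr y) p -> uniq (inr y :: p) -> last (inr y) p = inl d ->
    head (inr y) p != inl x ->
  exists r x' q, [/\ p = map inr r ++ inl x' :: map inl q,
    x = a /\ x' = b \/ x = b /\ x' = a, has_spath s t (size r).+1 & is_spath x' q d].
Proof.
move=> lxy pp up lp hp.
have [[r Ep]|[r [x' [p' [Ep pr lx' pp']]]]] := glue_path_exit_right pp.
  by rewrite Ep last_map in lp.
have {}up : uniq (map inr (y :: r) ++ inl x' :: p') by rewrite /= -Ep.
move: (up); rewrite cat_uniq (map_inj_uniq inr_inj) => /and3P[ur drp up'].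
have notin_p' z : z \in y :: r -> inr z \notin p'.
  move=> zr; apply: contra drp => zp'; apply/hasP; exists (inr z); first by rewrite inE zp' orbT.
  exact: map_f.
have spath_r : has_spath y (last y r) (size r).+1 by exists r.
have nxx' : x' != x.
  apply: contraNneq hp => Ex; rewrite Ex in lx'; rewrite -(link_functional lxy lx') in spath_r.
  by have [/size0nil Er] := has_spath_refl spath_r; rewrite Ep Er Ex.
have yr := notin_p' _ (mem_head y r); have lr := notin_p' _ (mem_last y r).
have link_ends := link_neq lxy lx' nxx'.
have [q Eq] : exists q, p' = map inl q.
  apply: glue_path_avoiding_right pp' _ _; by case: link_ends => -[_ Ey _ El]; rewrite -?Ey -?El.
exists r, x', q; split; first by rewrite Ep Eq.
- by case: link_ends => -[-> _ -> _]; auto.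
- case: link_ends spath_r => -[_ -> _ ->] //; exact: has_spath_sym.
- apply: (@is_spath_map _ glue_graph _ inl_inj glue_adj_inl); rewrite -Eq; split=> //.
  by rewrite -lp Ep last_cat.
Qed.

Lemma glue_spath c d n : @has_spath glue_graph (inl c) (inl d) n ->
  has_spath c d n \/
  exists n1 n2, [/\ has_disjoint_spaths c a b d n1 \/ has_disjoint_spaths c b a d n1,
    has_spath s t n2 & n = n1 + n2].
Proof.
case=> p [pp lp up] ->.
have [[q Ep]|[q [y [p' [Ep pq lqy pp']]]]] := glue_path_exit_left pp.
  left; exists q; last by rewrite Ep size_map.
  by apply: (@is_spath_map _ glue_graph _ inl_inj glue_adj_inl); rewrite -Ep.
right; have {}up : uniq (map inl (c :: q) ++ inr y :: p') by rewrite /= -Ep.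
move: (up); rewrite cat_uniq (map_inj_uniq inl_inj) => /and3P[uq dqp up'].
have lp' : last (inr y) p' = inl d by move: lp; rewrite Ep last_cat.
have hp' : head (inr y) p' != inl (last c q).
  apply: contra dqp; case: p' {Ep pp' up up' lp'} => //= u p' /eqP->.
  by rewrite (map_f inl (mem_last c q)) orbT.
have [r [x' [q' [Ep' xx' Hr [pq' lq' uq']]]]] := glue_path_return lqy pp' up' lp' hp'.
exists ((size q).+1 + (size q').+1), (size r).+1; split=> //; last first.
  by rewrite Ep Ep' !size_cat /= size_cat /= !size_map !addnS !addSn -addnA [size r + _]addnC.
have dqq' : ~~ has [in c :: q] (x' :: q').
  apply: contra dqp => /hasP[v vq' vq]; apply/hasP; exists (inl v); last exact: map_f.
  by rewrite inE Ep' mem_cat -(map_cons inl) (map_f inl vq') !orbT.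
by case: xx' => -[lq Ex']; [left|right]; exists q, q'; split=> //; rewrite -?Ex'.
Qed.

Lemma glue_cycle_inl x p : @is_cycle glue_graph (inl x :: p) ->
  has_cycle H (size p).+1 \/
  exists n1 n2, [/\ has_spath a b n1, has_spath s t n2 & (size p).+1 = n1 + n2].
Proof.
move=> Hc; have [_ /andP[]] := Hc; rewrite /= rcons_path => /andP[pp _] _.
have [[q Ep]|[q [y [p' [Ep _ lqy _]]]]] := glue_path_exit_left pp.
  rewrite Ep -(map_cons inl) in Hc; left; exists (x :: q); last by rewrite Ep /= size_map.
  exact: (@is_cycle_map _ glue_graph _ inl_inj glue_adj_inl).
right; rewrite {}Ep -cat_cons in Hc *; case: (is_cycle_catC Hc) => sc.
rewrite /ucycle /= rcons_path => /andP[/andP[pc _] uc].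
have lc : last (inr y) (p' ++ inl x :: map inl q) = inl (last x q).
  by rewrite last_cat /= last_map.
have hc : head (inr y) (p' ++ inl x :: map inl q) != inl (last x q).
  by rewrite -lc head_neq_last //; case/andP: uc.
have [r [x' [q' [Er xx' Hr Hq']]]] := glue_path_return lqy pc uc lc hc.
exists (size q').+1, (size r).+1; split=> //.
  have Hx' : has_spath x' (last x q) (size q').+1 by exists q'.
  by case: xx' Hx' => -[-> ->] //; apply: has_spath_sym.
have := congr1 size Er; rewrite !size_cat /= !size_map => Esize.
by rewrite -addSn addnC addSn Esize -addSn addnC.
Qed.

Lemma glue_cycle n : has_cycle glue_graph n ->
  [\/ has_cycle H n, has_cycle A n |
   exists n1 n2, [/\ has_spath a b n1, has_spath s t n2 & n = n1 + n2]].
Proof.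
case=> -[[] //|[x|y] p] Hc ->; first by case: (glue_cycle_inl Hc); [constructor 1|constructor 3].
have [_ /andP[]] := Hc; rewrite /= rcons_path => /andP[pp _] _.
have [[r Ep]|[r [x [p' [Ep _ _ _]]]]] := glue_path_exit_right pp.
  rewrite Ep -(map_cons inr) in Hc; constructor 2.
  exists (y :: r); last by rewrite Ep /= size_map.
  exact: (@is_cycle_map _ glue_graph _ inr_inj glue_adj_inr).
rewrite Ep -cat_cons in Hc; have := glue_cycle_inl (is_cycle_catC Hc).
rewrite (_ : (size (p' ++ _)).+1 = (size p).+1); last first.
  by rewrite Ep !size_cat /= addnC addSnnS.
by case; [constructor 1|constructor 3].
Qed.

Lemma glue_spath_links n : @has_spath glue_graph (inl a) (inl b) n ->
  has_spath a b n \/ exists2 n', has_spath s t n' & n = 2 + n'.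
Proof.
case/glue_spath=> [|[n1 [n2 [Hn1 Hn2 ->]]]]; [by left|right; exists n2 => //].
by case: Hn1 => [/has_disjoint_spaths_refl->|/has_disjoint_spaths_common_source].
Qed.

Lemma glue_spath_order4 c d n : #|H| = 4 -> uniq [:: a; b; c; d] ->
    @has_spath glue_graph (inl c) (inl d) n ->
  has_spath c d n \/ exists2 n', has_spath s t n' & n = 4 + n'.
Proof.
move=> cardH distinct; case/glue_spath=> [|[n1 [n2 [Hn1 Hn2 ->]]]]; [by left|right].
have perm_uniq4 x y : perm_eq [:: c; x; y; d] [:: a; b; c; d] -> uniq [:: c; x; y; d].
  by move/perm_uniq->.
exists n2 => //; congr (_ + _); apply/eqP; rewrite eqn_leq andbC -{2}cardH.
by case: Hn1; apply: has_disjoint_spaths_bounds; apply: perm_uniq4; apply/permP=> f /=; lia.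
Qed.

Lemma linkE x y : link x y = (x == a) * (y == s) + (x == b) * (y == t) :> nat.
Proof.
rewrite /link; case: (x =P a) => [->|_]; last by rewrite mul0n add0n mulnb.
by rewrite (negbTE ab) orbF mul1n addn0.
Qed.

Lemma glue_degree_inl (x : H) :
  #|neighbours (inl x : glue_graph)| = #|neighbours x| + (x == a) + (x == b).
Proof.
rewrite !card_neighbours big_sumType /= -addnA; congr (_ + _).
under eq_bigr do rewrite linkE.
by rewrite big_split -!big_distrr /= !sum_nat_eq_op !muln1.
Qed.

Lemma glue_degree_inr (y : A) :
  #|neighbours (inr y : glue_graph)| = #|neighbours y| + (y == s) + (y == t).
Proof.
rewrite !card_neighbours big_sumType /= -addnA addnC; congr (_ + _).
under eq_bigr do rewrite linkE.
by rewrite big_split -!big_distrl /= !sum_nat_eq_op !mul1n.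
Qed.

End DistinctEnds.

End Glue.

Record gadget := Gadget {
  gadget_graph :> sgraph;
  src : gadget_graph;
  tgt : gadget_graph;
  src_neq_tgt : src != tgt
}.

Arguments src {g}.
Arguments tgt {g}.

Definition terminals (A : gadget) : {set A} := [set src; tgt].

Definition cubic_gadget (A : gadget) : Prop :=
  forall x : A, #|neighbours x| + (x == src) + (x == tgt) = 3.

Definition gadget_2conn (A : gadget) : Prop :=
  anchored (terminals A) /\ connected_minus (set0 : {set A}).

Lemma fans_gadget_2conn (A : gadget) :
    (forall x : A, exists p q, [/\ path adj x p && (last x p == src),
       path adj x q && (last x q == tgt) & ~~ has [in p] q]) ->
  gadget_2conn A.
Proof.
move=> fan; have anchA : anchored (terminals A).
  move=> X x cX xX; have [p [q [/andP[pp /eqP lp] /andP[pq /eqP lq] dpq]]] := fan x.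
  by apply: (fan_reaches pp _ pq _ dpq cX xX); rewrite ?lp ?lq !inE eqxx ?orbT.
split=> //; apply: (@connected_minus_via _ _ src) => x x0.
have [|u] := anchA set0 x _ x0; first by rewrite cards0.
rewrite setD0 !inE => /orP[]/eqP-> // xt; apply: connect_trans xt _.
have [p [_ [/andP[pp /eqP <-] _ _]]] := fan tgt; apply: path_avoiding_connect => //.
by apply/hasPn=> v _; rewrite inE.
Qed.

Lemma gadget_card_gt1 (A : gadget) : 1 < #|A|.
Proof. by apply/card_gt1P; exists src, tgt; split; rewrite ?src_neq_tgt. Qed.

Section GlueConnectivity.

Variables (H : sgraph) (A : gadget) (a b : H).
Hypothesis ab : a != b.

Let G : sgraph := glue_graph a b (@src A) tgt.
Variable X : {set G}.

Let XH : {set H} := inl @^-1: X.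
Let XA : {set A} := inr @^-1: X.

Lemma connect_inl x y : connect (adj_minus XH) x y -> connect (@adj_minus G X) (inl x) (inl y).
Proof. by apply: (@connect_homo _ _ _ (@adj_minus G X)) => u v; rewrite /adj_minus /= !inE. Qed.

Lemma connect_inr x y : connect (adj_minus XA) x y -> connect (@adj_minus G X) (inr x) (inr y).
Proof. by apply: (@connect_homo _ _ _ (@adj_minus G X)) => u v; rewrite /adj_minus /= !inE. Qed.

Lemma connect_link x y : link a b src tgt x y -> x \notin XH -> y \notin XA ->
  connect (@adj_minus G X) (inl x) (inr y).
Proof. by rewrite !inE => xy xX yX; apply: connect1; rewrite /adj_minus /= xX yX. Qed.

Lemma one_side_intact : #|X| <= 1 -> XH = set0 \/ XA = set0.
Proof.
move=> cX; have [|/set0Pn[x xX]] := eqVneq XH set0; [by left|right].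
apply/setP=> y; rewrite !inE; apply/negP=> yX; rewrite inE in xX.
by have := card_le1_eqP cX _ _ xX yX.
Qed.

Lemma glue_connected_minus : XA = set0 -> connected_minus (set0 : {set A}) ->
    (forall x, x \notin XH -> reaches XH [set a; b] x) -> connected_minus X.
Proof.
move=> XA0 cA rH; apply: (@connected_minus_via G X (inr src)).
have conn_right z : connect (@adj_minus G X) (inr z) (inr src).
  by apply: connect_inr; rewrite XA0; apply: cA; rewrite inE.
move=> [x|//] xX; have [|u] := rH x; first by rewrite inE.
rewrite inE => /andP[uX uab] xu; have [z uz] := @link_left _ A _ _ src tgt _ uab.
apply: connect_trans (connect_inl xu) _; apply: connect_trans (conn_right z).
by apply: connect_link; rewrite ?XA0 ?in_set0.
Qed.

Lemma glue_reaches_left y : #|X| <= 1 -> gadget_2conn A -> y \notin XA ->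
  exists2 x, x \notin XH & connect (@adj_minus G X) (inr y) (inl x).
Proof.
move=> cX [anchA cA] yX; have [XH0|XA0] := one_side_intact cX.
  have [z] := anchA XA y (card_preimset_le1 inr_inj cX) yX; rewrite inE => /andP[zX zst] yz.
  have [x xz] := link_right a b zst; exists x; first by rewrite XH0 inE.
  apply: connect_trans (connect_inr yz) _; rewrite adj_minus_sym.
  by apply: connect_link; rewrite // XH0 in_set0.
have [x xab xX] : exists2 x, x \in [set a; b] & x \notin XH.
  have [aX|] := boolP (a \in XH); last by exists a; rewrite ?set21.
  exists b; rewrite ?set22 //; apply: contra ab => bX.
  by rewrite (card_le1_eqP (card_preimset_le1 inl_inj cX) _ _ aX bX).
have [z xz] := @link_left _ A _ _ src tgt _ xab; exists x => //.
apply: (@connect_trans G _ (inr z)).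
  by apply: connect_inr; rewrite XA0; apply: cA; rewrite inE.
by rewrite adj_minus_sym; apply: connect_link; rewrite // XA0 in_set0.
Qed.

End GlueConnectivity.

Definition glue (H A : gadget) (a b : H) : gadget :=
  @Gadget (glue_graph a b (@src A) tgt) (inl src) (inl tgt) (src_neq_tgt H).

Lemma glue_cubic_gadget (H A : gadget) (a b : H) : a != b ->
    (forall x : H, #|neighbours x| + (x == a) + (x == b) + (x == src) + (x == tgt) = 3) ->
  cubic_gadget A -> cubic_gadget (glue A a b).
Proof.
move=> ab cH cA [x|y]; first by rewrite glue_degree_inl // -[RHS](cH x).
by rewrite glue_degree_inr // !addn0 cA.
Qed.

Lemma glue_2conn (H A : gadget) (a b : H) : a != b -> anchored (terminals H) ->
    (forall x, reaches set0 [set a; b] x) -> gadget_2conn A ->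
  gadget_2conn (glue A a b).
Proof.
move=> ab anchH rH [anchA cA]; split; last first.
  apply: glue_connected_minus => // [|x _]; first by apply/setP=> y; rewrite !inE.
  by rewrite (_ : _ @^-1: _ = set0) //; apply/setP=> z; rewrite !inE.
move=> X y cX yX.
have anch_left x : inl x \notin X -> reaches X (terminals (glue A a b)) (inl x).
  move=> xX; have [|u] := anchH _ x (card_preimset_le1 inl_inj cX); first by rewrite inE.
  by rewrite !inE => uX xu; exists (inl u); [rewrite !inE|apply: connect_inl].
case: y yX => [x|y] yX; first exact: anch_left.
have [|x] := @glue_reaches_left _ _ _ _ ab X y cX (conj anchA cA); rewrite inE // => xX yx.
have [u uX xu] := anch_left x xX; exists u => //; exact: connect_trans xu.
Qed.

Lemma glue_terminals_2conn (H A : gadget) : anchored (terminals H) -> gadget_2conn A ->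
  gadget_2conn (glue A (@src H) tgt).
Proof.
move=> anchH; apply: (glue_2conn (src_neq_tgt H) anchH) => x.
by apply: anchH; rewrite ?cards0 ?inE.
Qed.

Lemma glue_vertex_connected (H A : gadget) : gadget_2conn H -> gadget_2conn A ->
  vertex_connected 2 (glue A (@src H) tgt).
Proof.
move=> [anchH cH] [anchA cA]; split.
  by rewrite card_glue (leq_add (gadget_card_gt1 H) (ltnW (gadget_card_gt1 A))).
move=> X; rewrite ltnS => cX; have [XH0|XA0] := one_side_intact cX; last first.
  by apply: glue_connected_minus => // x; apply: anchH (card_preimset_le1 inl_inj cX).
have conn_left x : connect (@adj_minus (glue A (@src H) tgt) X) (inl x) (inl src).
  by apply: connect_inl; rewrite XH0; apply: cH; rewrite inE.
apply: (@connected_minus_via (glue A (@src H) tgt) X (inl src)) => -[x|y] yX //.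
have [|x _ yx] := @glue_reaches_left _ _ _ _ (src_neq_tgt H) X y cX (conj anchA cA).
  by rewrite inE.
exact: connect_trans yx (conn_left x).
Qed.

Lemma glue_cubic (H A : gadget) : cubic_gadget H -> cubic_gadget A ->
  cubic (glue A (@src H) tgt).
Proof. by move=> cH cA [x|y]; rewrite (glue_degree_inl, glue_degree_inr) ?src_neq_tgt. Qed.

Section UnderlyingGraph.

Variables (T : finType) (r : rel T).

Definition underlying_adj : rel T := [rel x y | (x != y) && (r x y || r y x)].

Lemma underlying_adj_sym : symmetric underlying_adj.
Proof. by move=> x y; rewrite /underlying_adj /= eq_sym orbC. Qed.

Lemma underlying_adj_irrefl : irreflexive underlying_adj.
Proof. by move=> x; rewrite /underlying_adj /= eqxx. Qed.

Definition underlying_graph : sgraph := SGraph underlying_adj_sym underlying_adj_irrefl.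

End UnderlyingGraph.

Lemma sum_pair (I J : finType) (F : I * J -> nat) : \sum_x F x = \sum_i \sum_j F (i, j).
Proof. by rewrite pair_bigA; apply: eq_bigr => -[]. Qed.

Section Wrap.

Variable w : bool.

Definition two_vertices : gadget :=
  @Gadget (underlying_graph (fun _ _ : bool => w)) true false isT.

Definition wrap (A : gadget) : gadget := glue A (@src two_vertices) tgt.

Lemma two_vertices_spath n : @has_spath two_vertices src tgt n -> w /\ n = 2.
Proof.
move=> Hn; have := has_spath_leq_card Hn; rewrite card_bool.
by case: Hn => -[|x [|y p]] [/= pp lp _] ->; rewrite //= in pp *; case: x w pp {lp} => [] [].
Qed.

Lemma two_vertices_acyclic n : ~ has_cycle two_vertices n.
Proof. by move/has_cycle_bounds; rewrite card_bool; lia. Qed.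

Lemma two_vertices_anchored : anchored (terminals two_vertices).
Proof. by move=> X x _ xX; exists x; rewrite ?connect0 // !inE xX; case: x {xX}. Qed.

Lemma wrap_2conn A : gadget_2conn A -> gadget_2conn (wrap A).
Proof. exact/glue_terminals_2conn/two_vertices_anchored. Qed.

Lemma wrap_spath A n : @has_spath (wrap A) src tgt n ->
  w /\ n = 2 \/ exists2 n', @has_spath A src tgt n' & n = 2 + n'.
Proof. by case/(glue_spath_links (src_neq_tgt _)) => [/two_vertices_spath|]; [left|right]. Qed.

Lemma wrap_cycle A n : has_cycle (wrap A) n ->
  has_cycle A n \/ w /\ exists2 n', @has_spath A src tgt n' & n = 2 + n'.
Proof.
case/(glue_cycle (src_neq_tgt _)) => [/two_vertices_acyclic//| |]; first by left.
by case=> n1 [n2 [/two_vertices_spath[-> ->] Hn2 ->]]; right; split=> //; exists n2.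
Qed.

Lemma wrap_degree_terminal A (x : two_vertices) : #|neighbours (inl x : wrap A)| = w.+1.
Proof.
rewrite glue_degree_inl ?src_neq_tgt // card_neighbours big_bool /= /underlying_adj /=.
by case: x; case: w.
Qed.

End Wrap.

Lemma wrap_cubic_gadget A : cubic_gadget A -> cubic_gadget (wrap true A).
Proof.
apply: glue_cubic_gadget => // x; rewrite card_neighbours big_bool /= /underlying_adj /=.
by case: x.
Qed.

Definition double (D : gadget) : gadget := glue D (@src (wrap false D)) tgt.

Lemma double_2conn D : gadget_2conn D -> gadget_2conn (double D).
Proof. by move=> HD; have [anchW _] := wrap_2conn false HD; apply: glue_terminals_2conn. Qed.

Lemma double_cubic_gadget D : cubic_gadget D -> cubic_gadget (double D).
Proof.
move=> cD; apply: glue_cubic_gadget => // -[x|y]; first by rewrite wrap_degree_terminal; case: x.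
by rewrite glue_degree_inr // !addn0 cD.
Qed.

Lemma double_spath D n : @has_spath (double D) src tgt n ->
  exists2 n', @has_spath D src tgt n' & n = 2 + n'.
Proof. by case/(glue_spath_links (src_neq_tgt _)) => // /wrap_spath[[]|]. Qed.

Lemma double_cycle D n : has_cycle (double D) n ->
  has_cycle D n \/
  exists n1 n2, [/\ @has_spath D src tgt n1, @has_spath D src tgt n2 & n = 2 + n1 + n2].
Proof.
case/(glue_cycle (src_neq_tgt _)) => [/wrap_cycle[|[]//]| |]; [by left|by left|].
by case=> n1 [n2 [/wrap_spath[[]//|[n1' Hn1 ->]] Hn2 ->]]; right; exists n1', n2.
Qed.

Section Quad.

Variable chord : bool.

(* The chord joins the two vertices that are not terminals. *)
Definition quad : gadget :=
  @Gadget (underlying_graph [rel x y : bool * bool | (x.1 != y.1) || chord && x.1])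
    (false, false) (false, true) isT.

Lemma card_quad : #|quad| = 4.
Proof. by rewrite card_prod card_bool. Qed.

Lemma quad_degree (x : quad) : #|neighbours x| = 2 + (chord && x.1).
Proof.
rewrite card_neighbours sum_pair !big_bool /= /underlying_adj /=.
by case: x chord => [[] []] [].
Qed.

Lemma quad_2conn : gadget_2conn quad.
Proof.
apply: fans_gadget_2conn => -[[] i].
- by exists [:: @src quad], [:: @tgt quad]; case: i.
- case: i; first by exists [:: (true, true); @src quad], [::].
  by exists [::], [:: (true, true); @tgt quad].
Qed.

End Quad.

Definition square : gadget := quad false.

Lemma square_bipartite (x y : square) : adj x y -> x.1 != y.1.
Proof. by case/andP=> _; rewrite /= !orbF eq_sym orbb eq_sym. Qed.

Lemma square_spath (x y : square) n : x.1 = y.1 -> x != y -> has_spath x y n -> n = 3.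
Proof.
move=> x1 xy Hn; have := has_spath_leq_card Hn; rewrite card_quad.
have : 2 < n by apply: has_spath_nonadj Hn; rewrite //= /underlying_adj /= x1 eqxx andbF.
by have /= := bipartite_spath square_bipartite Hn; rewrite x1 eqxx; lia.
Qed.

Lemma square_cycle n : has_cycle square n -> n = 4.
Proof.
move=> Hn; have := has_cycle_bounds Hn; rewrite card_quad.
by have := bipartite_cycle square_bipartite Hn; lia.
Qed.

Definition cross (A : gadget) : gadget := @glue square A (true, false) (true, true).

Lemma cross_2conn A : gadget_2conn A -> gadget_2conn (cross A).
Proof.
have [anchQ connQ] := quad_2conn false; apply: glue_2conn => //.
by apply: connected_reaches connQ _; apply/set0Pn; exists (true, false); rewrite set21.
Qed.

Lemma cross_cubic_gadget A : cubic_gadget A -> cubic_gadget (cross A).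
Proof. by apply: glue_cubic_gadget => // x; rewrite quad_degree; case: x => [[] []]. Qed.

Lemma cross_spath A n : @has_spath (cross A) src tgt n ->
  n = 3 \/ exists2 n', @has_spath A src tgt n' & n = 4 + n'.
Proof.
case/(glue_spath_order4 _ (card_quad false)) => // [Hn|]; last by right.
by left; apply: square_spath Hn.
Qed.

Lemma cross_cycle A n : has_cycle (cross A) n ->
  [\/ n = 4, has_cycle A n | exists2 n', @has_spath A src tgt n' & n = 3 + n'].
Proof.
case/glue_cycle=> // [/square_cycle| |]; [by constructor 1|by constructor 2|].
by case=> n1 [n2 [/square_spath-> // Hn2 ->]]; constructor 3; exists n2.
Qed.

Definition diamond : gadget := quad true.

Lemma diamond_spath n : @has_spath diamond src tgt n -> n = 3 \/ n = 4.
Proof.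
move=> Hn; have := has_spath_leq_card Hn; rewrite card_quad.
by have : 2 < n by [apply: has_spath_nonadj Hn]; lia.
Qed.

Lemma diamond_cycle n : has_cycle diamond n -> n = 3 \/ n = 4.
Proof. by move/has_cycle_bounds; rewrite card_quad; lia. Qed.

Lemma diamond_cubic_gadget : cubic_gadget diamond.
Proof. by move=> x; rewrite quad_degree; case: x => [[] []]. Qed.

Definition k33_minus_edge : gadget :=
  @Gadget (underlying_graph [rel x y : bool * 'I_3 | (x.1 != y.1) && (x.2 != ord0)])
    (false, ord0) (true, ord0) isT.

Lemma card_k33_minus_edge : #|k33_minus_edge| = 6.
Proof. by rewrite card_prod card_bool card_ord. Qed.

Lemma k33_minus_edge_bipartite (x y : k33_minus_edge) : adj x y -> x.1 != y.1.
Proof. by case/andP=> _ /orP[]/andP[]; rewrite // eq_sym. Qed.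

Lemma k33_minus_edge_spath n : @has_spath k33_minus_edge src tgt n -> n = 4 \/ n = 6.
Proof.
move=> Hn; have := has_spath_leq_card Hn; rewrite card_k33_minus_edge.
have : 2 < n by apply: has_spath_nonadj Hn.
by have /= := bipartite_spath k33_minus_edge_bipartite Hn; lia.
Qed.

Lemma k33_minus_edge_cycle n : has_cycle k33_minus_edge n -> n = 4 \/ n = 6.
Proof.
move=> Hn; have := has_cycle_bounds Hn; rewrite card_k33_minus_edge.
by have := bipartite_cycle k33_minus_edge_bipartite Hn; lia.
Qed.

Lemma k33_minus_edge_cubic_gadget : cubic_gadget k33_minus_edge.
Proof.
move=> x; rewrite card_neighbours sum_pair big_bool !big_ord_recl !big_ord0.
by case: x => -[] [[|[|[|i]]]].
Qed.

Lemma k33_minus_edge_2conn : gadget_2conn k33_minus_edge.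
Proof.
apply: fans_gadget_2conn => -[i j]; pose one : 'I_3 := @Ordinal 3 1 isT.
have [->|j0] := eqVneq j ord0.
  case: i; first by exists [:: (false, one); (true, one); @src k33_minus_edge], [::].
  by exists [::], [:: (true, one); (false, one); @tgt k33_minus_edge].
case: i; last first.
  by exists [:: (true, j); @src k33_minus_edge], [:: @tgt k33_minus_edge]; case: j j0 => -[|[|[|]]].
by exists [:: @src k33_minus_edge], [:: (false, j); @tgt k33_minus_edge]; case: j j0 => -[|[|[|]]].
Qed.

Lemma double_diamond_cycle_div3 n :
  has_cycle (double diamond) n -> 3 %| n -> n = 3 \/ n = 9.
Proof.
by case/double_cycle=> [/diamond_cycle|[n1 [n2 [/diamond_spath + /diamond_spath + ->]]]]; lia.
Qed.

Lemma double_k33_minus_edge_cycle_div3 n :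
  has_cycle (double k33_minus_edge) n -> 3 %| n -> n = 6 \/ n = 12.
Proof.
case/double_cycle=> [/k33_minus_edge_cycle|]; first by lia.
by case=> n1 [n2 [/k33_minus_edge_spath + /k33_minus_edge_spath + ->]]; lia.
Qed.

Definition exceptional_spath (z : nat) (A : gadget) : Prop :=
  z %% 3 = 2 /\ forall n, @has_spath A src tgt n -> 3 %| n \/ n = z.

Definition step (A : gadget) : gadget := cross (wrap true A).

Lemma card_iter_step n (A : gadget) : n <= #|iter n step A|.
Proof.
elim: n => // n IH; apply: leq_ltn_trans IH _.
by rewrite !card_glue card_quad addnA 2!addSn ltnS leq_addl.
Qed.

Lemma step_exceptional_spath z A :
  exceptional_spath z A -> exceptional_spath (6 + z) (step A).
Proof.
case=> z_mod3 HA; split=> [|n]; first by lia.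
move=> /cross_spath[->|[_ /wrap_spath[[_ ->]|[n' /HA Hn' ->]] ->]]; [by left|by left|].
by case: Hn' => [|->]; [left|right]; lia.
Qed.

Definition ring (A B : gadget) : sgraph := glue (wrap true B) (@src A) tgt.

Lemma ring_vertex_connected A B : gadget_2conn A -> gadget_2conn B ->
  vertex_connected 2 (ring A B).
Proof. by move=> HA HB; apply: glue_vertex_connected (wrap_2conn true HB). Qed.

Lemma ring_cubic A B : cubic_gadget A -> cubic_gadget B -> cubic (ring A B).
Proof. by move=> HA HB; apply: glue_cubic (wrap_cubic_gadget HB). Qed.

Lemma card_ring (A B : gadget) : #|B| <= #|ring A B|.
Proof. by rewrite !card_glue addnA leq_addl. Qed.

Lemma ndvd_neq_mod d m k n : d %| m -> d %| k -> ~~ (d %| n) -> n <> m %[mod k].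
Proof. by move=> dm dk dn E; case/negP: dn; rewrite /dvdn -(modn_dvdm n dk) E modn_dvdm. Qed.

Section ModularLengths.

Variables m k : nat.

Definition avoids (G : sgraph) : Prop := forall n, has_cycle G n -> n <> m %[mod k].

Definition admissible (z : nat) (A : gadget) : Prop :=
  [/\ gadget_2conn A, cubic_gadget A, exceptional_spath z A & avoids A].

Hypotheses (m_div3 : 3 %| m) (k_div3 : 3 %| k).

Lemma avoids_div3 (G : sgraph) : (forall n, has_cycle G n -> 3 %| n -> n <> m %[mod k]) -> avoids G.
Proof.
move=> div3_neq n Hn; have [|n_ndiv3] := boolP (3 %| n); first exact: div3_neq.
exact: ndvd_neq_mod n_ndiv3.
Qed.

Lemma wrap_avoids w z A : exceptional_spath z A -> avoids A -> avoids (wrap w A).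
Proof.
move=> [z_mod3 HA] avA n /wrap_cycle[/avA //|[_ [n' /HA Hn' ->]]].
by apply: (ndvd_neq_mod m_div3 k_div3); case: Hn' => [|->]; lia.
Qed.

Lemma step_avoids z A : exceptional_spath z A -> avoids A -> avoids (step A).
Proof.
move=> HA avA n /cross_cycle[->|/(wrap_avoids HA avA)//|].
  exact: (ndvd_neq_mod m_div3 k_div3).
case: HA => z_mod3 HA [_ /wrap_spath[[_ ->]|[n' /HA Hn' ->]] ->];
  apply: (ndvd_neq_mod m_div3 k_div3) => //.
by case: Hn' => [|->]; lia.
Qed.

Lemma iter_step_admissible n z A :
  admissible z A -> admissible (6 * n + z) (iter n step A).
Proof.
move=> HA; elim: n => // n [conn cub exc av]; rewrite mulnS -addnA; split.
- exact/cross_2conn/wrap_2conn.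
- exact/cross_cubic_gadget/wrap_cubic_gadget.
- exact: step_exceptional_spath.
- exact: step_avoids exc av.
Qed.

Lemma ring_avoids z z' A B : admissible z A -> admissible z' B ->
  2 + z + z' <> m %[mod k] -> avoids (ring A B).
Proof.
move=> [_ _ [z_mod3 HA] avA] [_ _ HB avB] neq_m n /(glue_cycle (src_neq_tgt A))[/avA //| |].
  exact: wrap_avoids HB avB n.
case: HB => z'_mod3 HB [n1 [n2 [/HA Hn1 /wrap_spath Hn2 ->]]].
case: Hn2 => [[_ ->]|[n2' /HB Hn2 ->]].
  by apply: (ndvd_neq_mod m_div3 k_div3); case: Hn1 => [|->]; lia.
rewrite addnCA addnA; case: Hn1 Hn2 => [n1_div3|->] [n2_div3|->] //;
  by apply: (ndvd_neq_mod m_div3 k_div3); lia.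
Qed.

Hypothesis k_ge12 : 12 <= k.

Lemma double_diamond_admissible :
  m %% k != 3 -> m %% k != 9 -> admissible 5 (double diamond).
Proof.
move=> m_neq3 m_neq9; split.
- exact/double_2conn/quad_2conn.
- exact/double_cubic_gadget/diamond_cubic_gadget.
- by split=> // n /double_spath[n' /diamond_spath[]-> ->]; [right|left].
by apply: avoids_div3 => n Hn /(double_diamond_cycle_div3 Hn)[]->; rewrite modn_small; lia.
Qed.

Lemma double_k33_minus_edge_admissible :
  (m %% k == 3) || (m %% k == 9) -> admissible 8 (double k33_minus_edge).
Proof.
move=> m_3_or_9; split.
- exact/double_2conn/k33_minus_edge_2conn.
- exact/double_cubic_gadget/k33_minus_edge_cubic_gadget.
- by split=> // n /double_spath[n' /k33_minus_edge_spath[]-> ->]; [left|right].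
apply: avoids_div3 => n Hn /(double_k33_minus_edge_cycle_div3 Hn)[]->.
  by rewrite modn_small; lia.
move: k_ge12; rewrite leq_eqVlt => /orP[/eqP k_eq12|k_gt12]; last by rewrite modn_small; lia.
by rewrite {1}k_eq12 modnn; lia.
Qed.

Lemma exists_admissible : exists z A, admissible z A.
Proof.
have [m_3_or_9|/norP[]] := boolP ((m %% k == 3) || (m %% k == 9)).
  by exists 8, (double k33_minus_edge); apply: double_k33_minus_edge_admissible.
by exists 5, (double diamond); apply: double_diamond_admissible.
Qed.

End ModularLengths.

Lemma exists_affine_neq_mod d c m k N : ~~ (k %| d) ->
  exists2 n, N <= n & d * n + c <> m %[mod k].
Proof.
move=> kd; have [E|/eqP neq_m] := eqVneq ((d * N + c) %% k) (m %% k); last by exists N.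
exists N.+1 => //; rewrite -E mulnS -addnA => /eqP.
by rewrite -[_ * _ + _ in X in _ == X]add0n eqn_modDr mod0n -/(k %| d); apply/negP.
Qed.

Theorem theorem6p4 (m k N : nat) (hk : 12 <= k) (hm3 : 3 %| m) (hk3 : 3 %| k) :
  exists G : sgraph,
    [/\ vertex_connected 2 G,
        cubic G,
        N <= #|G|
      & forall c : seq G, is_cycle c -> size c <> m %[mod k]].
Proof.
have [z [A HA]] := exists_admissible hm3 hk3 hk.
have [n Nn neq_m] : exists2 n, N <= n & 6 * n + (2 + z + z) <> m %[mod k].
  by apply: exists_affine_neq_mod; rewrite gtnNdvd //; apply: leq_trans hk.
have HB := iter_step_admissible hm3 hk3 n HA.
have [connA cubA _ _] := HA; have [connB cubB _ _] := HB.
exists (ring A (iter n step A)); split.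
- exact: ring_vertex_connected.
- exact: ring_cubic.
- exact: leq_trans Nn (leq_trans (card_iter_step n A) (card_ring A _)).
- move=> c Hc; apply: (ring_avoids hm3 hk3 HA HB); last by exists c.
  by rewrite addnCA.
Qed.
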